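(* The following assertions hold. (i) For every $A>0$, there exist $n,m\in\mathbb{N}$ with $m\ge 1$ such that for $$\mathbf{x}=(+1)^m(-1)^{m-1}(-1,+1)(+1)^n\qquad\text{and}\qquad \hat{\mathbf{x}}=(+1)^m(-1)^{m-1}(+1)^n$$ we have $\mathbb{E}[\mathsf{H}(\mathcal{T}(\hat{\mathbf{x}}))]\ge \mathbb{E}[\mathsf{H}(\mathcal{T}(\mathbf{x}))]+A$. In particular, if $\bar{\mathbf{x}}=(+1)^m(-1)^{m-1}(+1)^{n+1}$, then $\mathbb{E}[\mathsf{H}(\mathcal{T}(\bar{\mathbf{x}}))]\ge \mathbb{E}[\mathsf{H}(\mathcal{T}(\mathbf{x}))]+A$. (ii) For every $A>0$, there exist $n,m\in\mathbb{N}$ with $m\ge 1$ such that for $$\mathbf{x}=(+1)^m(-1)^{m-1}(+1,-1)(+1)^n\qquad\text{and}\qquad \hat{\mathbf{x}}=(+1)^m(-1)^{m-1}(+1)^n$$ we have $\mathbb{E}[\mathsf{H}(\mathcal{T}(\hat{\mathbf{x}}))]\ge \mathbb{E}[\mathsf{H}(\mathcal{T}(\mathbf{x}))]+A$. (iii) There exists $n\in\mathbb{N}$ such that for $$\mathbf{x}=(+1,+1,-1)(+1)^n\qquad\text{and}\qquad \hat{\mathbf{x}}=(+1,-1)(+1)^n$$ we have $\mathbb{E}[\mathsf{H}(\mathcal{T}(\hat{\mathbf{x}}))]>\mathbb{E}[\mathsf{H}(\mathcal{T}(\mathbf{x}))]$.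
   Context: Uniform attachment with freezing. For a choice sequence $\mathbf{x}=(\mathrm{x}_i)_{1\le i\le m}\in\{-1,+1\}^m$ let $S_0(\mathbf{x})=1$ and $S_j(\mathbf{x})=1+\sum_{i=1}^j \mathrm{x}_i$ for $1\le j\le m$. Assume $S_j(\mathbf{x})>0$ for every $1\le j\le m-1$. Random rooted trees $\mathcal{T}_0(\mathbf{x}),\dots,\mathcal{T}_m(\mathbf{x})$, whose vertices are each labelled either active or frozen, are built recursively: $\mathcal{T}_0(\mathbf{x})$ is a single active root vertex; for $1\le j\le m$, let $V_j$ be a uniformly random active vertex of $\mathcal{T}_{j-1}(\mathbf{x})$, chosen independently of all previous choices; if $\mathrm{x}_j=-1$ (freezing step), $\mathcal{T}_j(\mathbf{x})$ is obtained from $\mathcal{T}_{j-1}(\mathbf{x})$ by changing the label of $V_j$ from active to frozen; if $\mathrm{x}_j=+1$ (attachment step), $\mathcal{T}_j(\mathbf{x})$ is obtained from $\mathcal{T}_{j-1}(\mathbf{x})$ by adding a new active vertex joined by an edge to $V_j$. Thus $S_j(\mathbf{x})$ is the number of active vertices of $\mathcal{T}_j(\mathbf{x})$. Set $\mathcal{T}(\mathbf{x})=\mathcal{T}_m(\mathbf{x})$. The height $\mathsf{H}(T)$ of a rooted tree $T$ is the maximal graph distance of a vertex of $T$ to the root. Notation: $(+1)^m$ is the sequence $(+1,\dots,+1)$ with $m$ entries, $(-1)^m$ is the sequence $(-1,\dots,-1)$ with $m$ entries (not numerical powers), and juxtaposition of sequences denotes concatenation. *)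

(* Defs.v *)
From HB Require Import structures.
From mathcomp Require Import all_boot all_order all_algebra.
From mathcomp Require Import reals.

Set Implicit Arguments.
Unset Strict Implicit.
Unset Printing Implicit Defensive.

Import Order.TTheory GRing.Theory Num.Theory.
Local Open Scope ring_scope.

(* The two values of a choice: [Attach] is +1 and [Freeze] is -1. *)
Inductive choice_step := Attach | Freeze.

Definition choice_val (s : choice_step) : int :=
  match s with Attach => 1 | Freeze => -1 end.

(* [nb_active (take j x)] is S_j(x). *)
Definition nb_active (x : seq choice_step) : int :=
  1 + \sum_(s <- x) choice_val s.

Section GraphDistance.
Variables (V : finType) (e : rel V).

Definition has_walk (k : nat) (u v : V) : bool :=
  [exists p : k.-tuple V, path e u p && (last u p == v)].

(* Least length of a walk from [u] to [v]. A shortest walk has fewer than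
   #|V| edges, so the search is exhaustive; the value is #|V| when [v] cannot
   be reached from [u], which does not happen in a tree. *)
Definition gdist (u v : V) : nat :=
  find (fun k => has_walk k u v) (iota 0 #|V|).

End GraphDistance.

(* A rooted graph whose vertices are labelled active (those in [active]) or
   frozen (the others). Only trees arise in the process below. *)
Record rtree := RTree {
  vertex : finType;
  root : vertex;
  adj : rel vertex;
  active : {set vertex}
}.

Definition height (T : rtree) : nat :=
  (\max_(v : vertex T) gdist (@adj T) (root T) v)%N.

Definition single_root : rtree :=
  @RTree unit tt (fun _ _ => false) [set: unit].

Definition freeze (T : rtree) (v : vertex T) : rtree :=
  @RTree (vertex T) (root T) (@adj T) (active T :\ v).

(* [Some] embeds the old vertices; the new vertex is [None]. *)
Definition attach (T : rtree) (v : vertex T) : rtree :=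
  @RTree (option (vertex T)) (Some (root T))
    (fun a b => match a, b with
                | Some a', Some b' => adj a' b'
                | Some a', None => a' == v
                | None, Some b' => b' == v
                | None, None => false
                end)
    (None |: [set Some u | u in active T]).

Definition grow (s : choice_step) (T : rtree) (v : vertex T) : rtree :=
  match s with Attach => attach v | Freeze => freeze v end.

Section Law.
Variable R : realType.

(* A finitely supported law on trees, as a list of weighted outcomes; the same
   tree may occur several times, and its weights then add up. *)
Definition flaw := seq (R * rtree).

Definition mass (d : flaw) : R := \sum_(o <- d) o.1.

Definition expect (d : flaw) (X : rtree -> R) : R := \sum_(o <- d) o.1 * X o.2.

(* Conditionally on the current tree, V is uniform among its active vertices. *)
Definition law_step (d : flaw) (s : choice_step) : flaw :=
  [seq (o.1 / #|active o.2|%:R, grow s v) | o <- d, v <- enum (active o.2)].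

(* The outcomes of [law x] are indexed by the sequences of choices
   (V_1, ..., V_m), each weighted by its probability. *)
Definition law (x : seq choice_step) : flaw :=
  foldl law_step [:: (1, single_root)] x.

Definition mean_height (x : seq choice_step) : R :=
  expect (law x) (fun T => (height T)%:R).

Lemma law_rcons x s : law (rcons x s) = law_step (law x) s.
Proof. by rewrite /law -cats1 foldl_cat. Qed.

Lemma nb_active_rcons x s : nb_active (rcons x s) = nb_active x + choice_val s.
Proof. by rewrite /nb_active -cats1 big_cat big_seq1 /= addrA. Qed.

Lemma card_active_grow s (T : rtree) (v : vertex T) : v \in active T ->
  #|active (grow s v)|%:Z = #|active T|%:Z + choice_val s.
Proof.
case: s => /= vT.
  rewrite cardsU1 card_imset; last exact: Some_inj.
  have /negbTE-> : None \notin [set Some u | u in active T].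
    by apply/imsetP => -[].
  by rewrite /= PoszD addrC.
by rewrite (cardsD1 v (active T)) vT /= PoszD addrC addrA.
Qed.

Definition active_total (n : int) (d : flaw) : bool :=
  all (fun o => #|active o.2|%:Z == n) d.

Lemma active_law_step n d s :
  active_total n d -> active_total (n + choice_val s) (law_step d s).
Proof.
rewrite /active_total /law_step; elim: d => //= o d IH /andP[/eqP on dn].
rewrite all_cat IH // andbT all_map; apply/allP => v /=.
by rewrite mem_enum => vT; rewrite card_active_grow // on.
Qed.

Lemma card_active_law x : active_total (nb_active x) (law x).
Proof.
elim/last_ind: x => [|x s IH]; last first.
  by rewrite law_rcons nb_active_rcons active_law_step.
by rewrite /active_total /law /= cardsT card_unit /nb_active big_nil addr0.
Qed.

Lemma mass_law_step n d s :
  0 < n -> active_total n d -> mass (law_step d s) = mass d.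
Proof.
move=> n0; rewrite /active_total /law_step /mass.
elim: d => //= o d IH /andP[/eqP on dn].
rewrite big_cat big_cons /= IH //; congr (_ + _).
rewrite big_map big_enum /= sumr_const -[LHS]mulr_natr divfK //.
by rewrite pnatr_eq0 -lt0n -ltz_nat on.
Qed.

Lemma mass_law x :
  (forall j, (j < size x)%N -> 0 < nb_active (take j x)) -> mass (law x) = 1.
Proof.
elim/last_ind: x => [|x s IH] Spos; first by rewrite /mass /law big_seq1.
rewrite law_rcons (mass_law_step _ _ (card_active_law x)).
  apply: IH => j jx; have := Spos j; rewrite size_rcons -cats1 takel_cat ?(ltnW jx) //.
  by apply; rewrite ltnW.
by have := Spos (size x); rewrite size_rcons -cats1 take_size_cat //; apply.
Qed.

End Law.

(* Main.v *)
Require Import Defs.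
From mathcomp Require Import all_boot all_order all_algebra.
From mathcomp Require Import boolp reals.
From mathcomp Require Import ring lra zify.

Import Order.TTheory GRing.Theory Num.Theory.
Local Open Scope ring_scope.

Set Implicit Arguments.
Unset Strict Implicit.
Unset Printing Implicit Defensive.

(** Freezing early can help because it is better to keep two active vertices than
one: the deeper of two vertices is deeper than a typical one.

Only the height and the depths of the active vertices matter
([mean_height_depth_step]). After [m] attachments and [m - 1] freezings, two
active vertices remain, distributed as a uniform pair in a random recursive
tree. If the [n] last attachments start from both, the deeper one, of depth
[max a b], carries one part of a tree whose mean height is that of one of two
trees sharing [n] vertices. By the Polya urn this is the average of the mean
heights for 0 to [n] attachments ([rrt2_fst]), and since mean heights grow at most
logarithmically ([rrt_height_log]) this average is within a constant of the full
mean height for infinitely many [n] ([balanced_time]). If one of the two vertices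
is frozen first, the growth starts from a depth [a] or [b] with probability 1/2
each. For [n] large the frozen part is overtaken ([half_pow_height_small]), so the
loss is half the mean of [|a - b|] up to a constant ([grown_pair_gain]).

That mean is unbounded in [m] ([gap_unbounded]). Passing from [k] to [k + 1]
vertices, the gap of a uniform pair makes a symmetric step [+1] or [-1] with
probability of order [1 / k]. Hence the mean of a function of the gap grows by
[1 / k] times the mean of its second difference. For the function
[x ^+ 2 - c * x ^+ 3] the second difference is bounded below when the mean gap is
bounded and [c] is small, and the harmonic series diverges, while the function
is at most a multiple of [x].

This gives the first assertion. In the second one, the two additional steps lead
to a parent and its child with probability 1/3, that is to the growth from a
single vertex, and otherwise change the depths by at most one
([attach_freeze_loses]). The third assertion is an exact comparison of the few
configurations after two or three steps; the heights with starting depths (1,1)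
and (2,0) are compared with those starting from (1,0) by convexity of the maximum
([grown_convex]). *)

(** * Averaging operators and trees as depth profiles *)

(** One step of every process below picks an element of a finite list uniformly
and moves accordingly. Its law is handled through the backward operator on
observables, so that the expectation of [f] after [n] steps from [st] is
[iter n (avg idx next) f st]. *)
Section Averages.
Variables (R : realType) (S : Type) (I : eqType).
Variables (idx : S -> seq I) (next : S -> I -> S).
Implicit Types (f g : S -> R) (st : S).

Definition avg f st : R :=
  (\sum_(i <- idx st) f (next st i)) / (size (idx st))%:R.

Lemma avg_le f g st :
  (forall i, i \in idx st -> f (next st i) <= g (next st i)) ->
  avg f st <= avg g st.
Proof.
move=> fg; apply: ler_wpM2r; first by rewrite invr_ge0.
by rewrite !big_seq; apply: ler_sum.
Qed.

Lemma avg_eq f g st :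
  (forall i, i \in idx st -> f (next st i) = g (next st i)) ->
  avg f st = avg g st.
Proof.
by move=> fg; apply: le_anti; rewrite !avg_le // => i /fg ->.
Qed.

Lemma avg_lin a f g st : avg (fun t => a * f t + g t) st = a * avg f st + avg g st.
Proof. by rewrite /avg big_split /= -mulr_sumr mulrDl mulrA. Qed.

Lemma avg_const c st : (0 < size (idx st))%N -> avg (fun=> c) st = c.
Proof.
move=> sz; rewrite /avg big_const_seq count_predT iter_addr_0 -[_ *+ _]mulr_natr mulfK //.
by rewrite pnatr_eq0 -lt0n.
Qed.

(** Two observables need only be compared on the states that can occur after
[k + n] steps, which an invariant indexed by time describes. *)
Section Invariant.
Variable Inv : nat -> S -> Prop.
Hypothesis Inv_next : forall k st i,
  Inv k st -> i \in idx st -> Inv k.+1 (next st i).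

Lemma iter_avg_le n k f g st :
  (forall t, Inv (k + n)%N t -> f t <= g t) -> Inv k st ->
  iter n avg f st <= iter n avg g st.
Proof.
elim: n k st => [|n IH] k st fg Ist /=; first by apply: fg; rewrite addn0.
apply: avg_le => i ist; apply: (IH k.+1); last exact: Inv_next ist.
by move=> t It; apply: fg; rewrite addnS -addSn.
Qed.

Lemma iter_avg_eq n k f g st :
  (forall t, Inv (k + n)%N t -> f t = g t) -> Inv k st ->
  iter n avg f st = iter n avg g st.
Proof.
by move=> fg Ist; apply: le_anti; rewrite !(iter_avg_le (k := k)) // => t /fg ->.
Qed.

Lemma iter_avg_const n k c st :
  (forall j t, (j < n)%N -> Inv (k + j)%N t -> (0 < size (idx t))%N) -> Inv k st ->
  iter n avg (fun=> c) st = c.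
Proof.
elim: n k st => [//|n IH] k st sz Ist /=.
rewrite -[RHS](@avg_const c st); last by apply: (sz 0%N); rewrite ?addn0.
apply: avg_eq => i ist; apply: (IH k.+1); last exact: Inv_next ist.
by move=> j t jn It; apply: (sz j.+1); rewrite // addnS -addSn.
Qed.

End Invariant.

Lemma iter_avg_lin n a f g st :
  iter n avg (fun t => a * f t + g t) st = a * iter n avg f st + iter n avg g st.
Proof.
elim: n st => [//|n IH] st /=; rewrite -avg_lin.
by apply: avg_eq => i _; rewrite IH.
Qed.

End Averages.

(** The height of the tree and the list of depths of its active vertices: this
pair evolves as a Markov chain by itself, and frozen vertices matter only
through the height already reached. *)
Definition state := (nat * seq nat)%type.

Definition next_state (s : choice_step) (st : state) (h : nat) : state :=
  match s with
  | Attach => (maxn st.1 h.+1, h.+1 :: st.2)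
  | Freeze => (st.1, rem h st.2)
  end.

Section Trees.
Variable R : realType.

Definition tree_avg (s : choice_step) (F : rtree -> R) (T : rtree) : R :=
  (\sum_(v in active T) F (grow s v)) / #|active T|%:R.

Lemma expect_law_step (d : flaw R) s F :
  expect (law_step d s) F = expect d (tree_avg s F).
Proof.
rewrite /expect /law_step; elim: d => [|o d IH]; first by rewrite !big_nil.
rewrite /= big_cat IH big_cons; congr (_ + _).
rewrite big_map big_enum /= /tree_avg mulr_suml mulr_sumr.
by apply: eq_bigr => v _; rewrite mulrAC mulrA.
Qed.

Lemma expect_law x F : expect (law R x) F = foldr tree_avg F x single_root.
Proof.
have gen d : expect (foldl (@law_step R) d x) F = expect d (foldr tree_avg F x).
  by elim: x d => [//|s x IH] d /=; rewrite IH expect_law_step.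
by rewrite /law gen /expect big_seq1 mul1r.
Qed.

End Trees.

(** A certificate that [d] is the distance to the root: [d] is 1-Lipschitz along
edges, hence a lower bound for the length of walks, and is attained. It passes
to a tree with one more leaf, whereas [gdist] itself has no such recursion. *)
Definition depth_of (T : rtree) (d : vertex T -> nat) : Prop :=
  [/\ d (Defs.root T) = 0%N,
      forall u v, adj u v -> (d v <= (d u).+1)%N,
      forall v, has_walk (@adj T) (d v) (Defs.root T) v
    & forall v, (d v < #|vertex T|)%N].

Lemma gdist_depth (T : rtree) (d : vertex T -> nat) v :
  depth_of d -> gdist (@adj T) (Defs.root T) v = d v.
Proof.
case=> d0 dadj dwalk dlt; rewrite /gdist.
have walk_ge k : has_walk (@adj T) k (Defs.root T) v -> (d v <= k)%N.
  have path_ge u p : path (@adj T) u p -> (d (last u p) <= d u + size p)%N.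
    elim: p u => [|w p IH] u /=; first by rewrite addn0.
    by case/andP=> /dadj uw /IH; rewrite addnS -addSn; lia.
  by case/existsP=> p /andP[/path_ge + /eqP lp]; rewrite lp d0 size_tuple.
set a := (fun k => _); set s := iota _ _.
have has_a : has a s by apply/hasP; exists (d v); [rewrite mem_iota add0n dlt|exact: dwalk].
have fs : (find a s < #|vertex T|)%N by rewrite -[X in (_ < X)%N](size_iota 0 #|_|) -has_find.
apply/eqP; rewrite eqn_leq; apply/andP; split.
  rewrite leqNgt; apply/negP => /(before_find 0%N).
  by rewrite nth_iota // add0n /a dwalk.
by have := nth_find 0%N has_a; rewrite nth_iota //; apply: walk_ge.
Qed.

Definition attach_depth (T : rtree) (d : vertex T -> nat) (v : vertex T) :
    vertex (attach v) -> nat :=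
  fun u => if u is Some w then d w else (d v).+1.

Arguments attach_depth [T] d v _ : simpl nomatch.

Lemma depth_of_attach (T : rtree) (d : vertex T -> nat) (v : vertex T) :
  depth_of d -> depth_of (attach_depth d v).
Proof.
case=> d0 dadj dwalk dlt.
have lift k w : has_walk (@adj T) k (Defs.root T) w ->
    exists p : k.-tuple (vertex (attach v)),
      path (@adj (attach v)) (Defs.root (attach v)) p
      /\ last (Defs.root (attach v)) p = Some w.
  case/existsP=> p /andP[pp /eqP <-]; exists (map_tuple Some p).
  by rewrite /= last_map path_map; split.
split=> [//|[u|] [w|] //=|[w|]|[w|]].
- exact: dadj.
- by move/eqP->.
- by move/eqP->; lia.
- have [p [pp lp]] := lift _ _ (dwalk w).
  by apply/existsP; exists p; rewrite pp lp /=.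
- have [p [pp lp]] := lift _ _ (dwalk v).
  apply/existsP; exists [tuple of rcons p None].
  by rewrite /= rcons_path pp lp last_rcons /= !eqxx.
- by rewrite card_option; apply: leqW; apply: dlt.
- by rewrite card_option ltnS; apply: dlt.
Qed.

Lemma depth_of_single : @depth_of single_root (fun=> 0%N).
Proof.
split=> [//|//|[]|_]; last by rewrite card_unit.
by apply/existsP; exists [tuple].
Qed.

Lemma height_depth (T : rtree) (d : vertex T -> nat) :
  depth_of d -> height T = (\max_v d v)%N.
Proof. by move=> dT; apply: eq_bigr => v _; apply: gdist_depth. Qed.

Section Reduction.
Variable R : realType.

Definition depth_step (s : choice_step) : (state -> R) -> state -> R :=
  avg snd (next_state s).

(** The choices of vertices become choices of depths: the list of depths of the
active vertices is followed up to permutation along the construction. *)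
Lemma mean_height_depth_step x :
  mean_height R x = foldr depth_step (fun st => st.1%:R) x (0%N, [:: 0%N]).
Proof.
rewrite /mean_height expect_law.
suff gen (T : rtree) (d : vertex T -> nat) l : depth_of d ->
    perm_eq l [seq d v | v <- enum (active T)] ->
    foldr (@tree_avg R) (fun T => (height T)%:R) x T
    = foldr depth_step (fun st => st.1%:R) x ((\max_v d v)%N, l).
  rewrite (gen _ _ [:: 0%N] depth_of_single) ?big1 //=.
  have /card1P[u eu] : #|[set: unit]| == 1%N by rewrite cardsT card_unit.
  by rewrite /= (eq_enum eu) enum1.
elim: x T d l => [|s x IH] T d l dT dl; first by rewrite /= (height_depth dT).
rewrite /= /tree_avg /depth_step /avg /= (perm_size dl) size_map -cardE.
congr (_ / _); rewrite (perm_big _ dl) /= big_map big_enum /=.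
apply: eq_bigr => v vT; case: s => /=.
  rewrite (IH (attach v) _ ((d v).+1 :: l) (depth_of_attach v dT)); last first.
    rewrite /= -(perm_cons (d v).+1) in dl; apply: (perm_trans dl).
    have -> : (d v).+1 :: [seq d w | w <- enum (active T)]
      = [seq attach_depth d v u | u <- None :: [seq Some w | w <- enum (active T)]].
      by rewrite /= -map_comp.
    apply/perm_map/uniq_perm; rewrite ?enum_uniq //=.
      rewrite map_inj_uniq ?enum_uniq ?andbT; last exact: Some_inj.
      by apply/mapP => -[].
    case=> [w|]; rewrite mem_enum !inE //= mem_map ?mem_enum ?mem_imset //;
    exact: Some_inj.
  congr (foldr _ _ _ (_, _)).
  apply/eqP; rewrite eqn_leq geq_max; apply/and3P; split.
  - apply/bigmax_leqP => -[w|] _ /=; last by rewrite leq_maxr.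
    by rewrite leq_max leq_bigmax.
  - apply/bigmax_leqP => w _.
    exact: leq_trans (leq_bigmax (Some w : vertex (attach v))).
  - exact: leq_trans (leq_bigmax (None : vertex (attach v))).
apply: (IH (freeze v) d) => //.
have dvl : d v \in l by rewrite (perm_mem dl) map_f // mem_enum.
rewrite -(perm_cons (d v)) perm_sym -(permPr (perm_to_rem dvl)) perm_sym (perm_trans dl) //.
rewrite -[_ :: _]/[seq d w | w <- v :: enum (active T :\ v)].
apply/perm_map/uniq_perm; rewrite /= ?enum_uniq ?andbT // ?mem_enum ?setD11 //.
by move=> w; rewrite inE !mem_enum in_setD1; case: eqVneq => [->|].
Qed.

End Reduction.

(** * The random recursive tree: logarithmic height, vanishing chance of staying low *)

Section SlowGrowth.
Variable R : realType.

(** Increments at least [6 / n.+1] from some rank on would add at least 3 each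
time the index doubles, against the allowed 2. This single fact is used four
times: for the mean height of the recursive tree, for the height of one part of
it, and, with bounded sequences, for the two divergence statements. *)
Lemma log_growth_slow_step (f : nat -> R) (B : R) :
    (forall k n, (n <= 2 ^ k)%N -> f n <= 2 * k%:R + B) ->
  forall N, exists2 n, (N <= n)%N & f n.+1 - f n < 6 / n.+1%:R.
Proof.
move=> fB N; apply: contrapT => /forall2NP Nf.
have step n : (N <= n)%N -> f n + 6 / n.+1%:R <= f n.+1.
  by move=> Nn; case: (Nf n) => // /negP; rewrite -leNgt lerBrDl.
have double M : (N <= M)%N -> (0 < M)%N -> f M + 3 <= f (M * 2)%N.
  move=> NM M0.
  have run j : (j <= M)%N -> f M + j%:R * (6 / (M * 2)%:R) <= f (M + j)%N.
    elim: j => [|j IH] jM; first by rewrite addn0 mul0r addr0.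
    rewrite addnS; apply: le_trans (step _ _); last by rewrite (leq_trans NM) ?leq_addr.
    rewrite -natr1 mulrDl mul1r addrA lerD ?IH ?(ltnW jM) // ler_wpM2l //.
    by rewrite lef_pV2 ?posrE ?ltr0n ?ler_nat //; lia.
  have := run M (leqnn M); rewrite addnn -muln2 natrM.
  have M0' : M%:R != 0 :> R by rewrite pnatr_eq0 -lt0n.
  by congr (_ + _ <= _); field.
have N2 : (N < 2 ^ N)%N by apply: ltn_expl.
have powers i : f (2 ^ N)%N + 3 * i%:R <= f (2 ^ (N + i))%N.
  elim: i => [|i IH]; first by rewrite addn0 mulr0 addr0.
  rewrite addnS expnSr; apply: le_trans (double _ _ _); last 2 first.
  - by rewrite (leq_trans (ltnW N2)) // leq_exp2l // leq_addr.
  - by rewrite expn_gt0.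
  by rewrite -natr1; lra.
have [i ib] : exists i : nat, 2 * N%:R + B - f (2 ^ N)%N < i%:R.
  exists (Num.bound `|2 * N%:R + B - f (2 ^ N)%N|).
  exact: le_lt_trans (ler_norm _) (archi_boundP (normr_ge0 _)).
have := le_trans (powers i) (fB _ _ (leqnn _)).
by rewrite natrD; lra.
Qed.

End SlowGrowth.

Section RecursiveTree.
Variable R : realType.
Implicit Types (f : state -> R) (st : state).

Definition attach_step : (state -> R) -> state -> R := depth_step Attach.
Definition freeze_step : (state -> R) -> state -> R := depth_step Freeze.
Definition root_state : state := (0%N, [:: 0%N]).

(** Expectation of [f] for the random recursive tree with [n] attachments, all of
whose vertices are active. *)
Definition rrt n f : R := iter n attach_step f root_state.

Definition rrt_inv n st := size st.2 = n.+1 /\ st.1 \in st.2.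

Lemma rrt_inv_next k st h :
  rrt_inv k st -> h \in st.2 -> rrt_inv k.+1 (next_state Attach st h).
Proof.
case=> sz Hs hs; split; rewrite /= ?sz // inE /maxn.
by case: ltnP => _; rewrite ?eqxx // Hs orbT.
Qed.

Lemma rrt_le n f g : (forall st, rrt_inv n st -> f st <= g st) -> rrt n f <= rrt n g.
Proof.
by move=> fg; apply: (iter_avg_le (k := 0%N) rrt_inv_next); [exact: fg|split].
Qed.

Lemma rrt_eq n f g : (forall st, rrt_inv n st -> f st = g st) -> rrt n f = rrt n g.
Proof. by move=> fg; apply: le_anti; rewrite !rrt_le // => st /fg ->. Qed.

Lemma rrt_lin n a f g : rrt n (fun t => a * f t + g t) = a * rrt n f + rrt n g.
Proof. exact: iter_avg_lin. Qed.

Lemma rrt_const n c : rrt n (fun=> c) = c.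
Proof.
apply: (iter_avg_const (k := 0%N) rrt_inv_next); last by split.
by move=> j t _ [-> _].
Qed.

Lemma rrtZ n a f : rrt n (fun t => a * f t) = a * rrt n f.
Proof.
rewrite -[RHS]addr0 -(rrt_const n 0) -rrt_lin.
by apply: rrt_eq => st _; rewrite addr0.
Qed.

Lemma rrtS n f : rrt n.+1 f = rrt n (attach_step f).
Proof. by rewrite /rrt iterSr. Qed.

Definition rrt_height n : R := rrt n (fun st => st.1%:R).

(** The exponential moment of the depth profile: it dominates [2 ^+ H] and has an
exact recursion, each attachment adding twice the term of a uniform vertex. *)
Definition pow2_sum st : R := \sum_(h <- st.2) 2 ^+ h.

Lemma rrt_pow2_sum n : rrt n pow2_sum = (n.+1 * n.+2)%:R / 2.
Proof.
elim: n => [|n IH].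
  by rewrite /rrt /= /pow2_sum big_seq1 expr0 mul1n divff // pnatr_eq0.
rewrite rrtS (@rrt_eq _ _ (fun st => (n.+3%:R / n.+1%:R) * pow2_sum st)).
  rewrite rrtZ IH !natrM; field.
  by rewrite nat1r pnatr_eq0.
move=> [H s] [/= sz _]; rewrite /attach_step /depth_step /avg /=.
under eq_bigr do rewrite /pow2_sum /= big_cons exprS.
rewrite big_split /= -mulr_sumr big_const_seq count_predT iter_addr_0 sz.
rewrite -/(pow2_sum (H, s)) -[_ *+ _]mulr_natr.
have n0 : n.+1%:R != 0 :> R by rewrite pnatr_eq0.
rewrite -[n.+3%:R]/((2 + n.+1)%:R) natrD.
by field; rewrite nat1r.
Qed.

(** Since [H <= 2 ^+ H / 4 ^+ k + 2 * k], the quadratic growth of the exponential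
moment bounds the mean height logarithmically. *)
Lemma rrt_height_log k n : (n <= 2 ^ k)%N -> rrt_height n <= 2 * k%:R + 3.
Proof.
move=> nk.
have pw : 0 < 4 ^+ k :> R by rewrite exprn_gt0.
have le1 : rrt_height n <= (4 ^+ k)^-1 * rrt n pow2_sum + 2 * k%:R.
  rewrite -[2 * k%:R](rrt_const n) -rrt_lin; apply: rrt_le => -[H s] [/= _ Hs].
  have Hw : 2 ^+ H <= pow2_sum (H, s).
    rewrite /pow2_sum /= (big_rem H) //= lerDl.
    by apply: sumr_ge0 => h _; rewrite exprn_ge0.
  have [Hk|kH] := leqP H (k + k)%N.
    have : 0 <= (4 ^+ k)^-1 * pow2_sum (H, s).
      apply: mulr_ge0; first by rewrite invr_ge0 ltW.
      by apply: le_trans Hw; rewrite exprn_ge0.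
    by move: Hk; rewrite -(ler_nat R) natrD; lra.
  have -> : H%:R = (H - (k + k))%:R + 2 * k%:R :> R.
    by rewrite natrB ?natrD; [ring|exact: ltnW].
  rewrite lerD2r mulrC ler_pdivlMr //; apply: le_trans Hw.
  have -> : H = (H - (k + k) + (k + k))%N by lia.
  have -> : 4 ^+ k = 2 ^+ (k + k) :> R by rewrite addnn -mul2n exprM; congr (_ ^+ _); ring.
  rewrite addnK (exprD _ (H - _)) ler_wpM2r ?exprn_ge0 //.
  by rewrite -natrX ler_nat ltnW // ltn_expl.
apply: le_trans le1 _; rewrite addrC lerD2l rrt_pow2_sum mulrC ler_pdivrMr //.
rewrite ler_pdivrMr // -natrX -!natrM ler_nat.
have -> : (4 ^ k = 2 ^ k * 2 ^ k)%N by rewrite -expnMn.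
by have := expn_gt0 2 k; nia.
Qed.

(** A quantity controlling the event that the tree is still low: the expected
defect of [H] below [m] is at most [2 ^+ m] times it. *)
Definition half_pow_height n : R := rrt n (fun st => 2^-1 ^+ st.1).

Lemma half_pow_height_ge0 n : 0 <= half_pow_height n.
Proof.
rewrite -[X in X <= _](rrt_const n 0); apply: rrt_le => st _.
by rewrite exprn_ge0 // invr_ge0.
Qed.

(** With probability at least [n.+1^-1] a deepest vertex is chosen and the height
increases, which halves [2^-1 ^+ H]. *)
Lemma half_pow_heightS n : half_pow_height n.+1 <= half_pow_height n - half_pow_height n / (2 * n.+1%:R).
Proof.
have -> : half_pow_height n - half_pow_height n / (2 * n.+1%:R)
        = (1 - (2 * n.+1%:R)^-1) * half_pow_height n by ring.
rewrite /half_pow_height rrtS -rrtZ; apply: rrt_le => -[H s] [/= sz Hs].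
rewrite /attach_step /depth_step /avg /= sz.
have hp m : 0 <= 2^-1 ^+ m :> R by rewrite exprn_ge0 // invr_ge0.
rewrite (big_rem H) //= ler_pdivrMr ?ltr0n //.
have -> : maxn H H.+1 = H.+1 by lia.
have rest : \sum_(h <- rem H s) 2^-1 ^+ maxn H h.+1 <= n%:R * 2^-1 ^+ H :> R.
  apply: (@le_trans _ _ (\sum_(h <- rem H s) 2^-1 ^+ H)).
    apply: ler_sum => h _; apply: ler_wiXn2l; rewrite ?invr_ge0 ?leq_maxl //.
    by rewrite invf_le1 // ler1n.
  by rewrite big_const_seq count_predT iter_addr_0 size_rem // sz /= mulr_natl.
rewrite [leRHS]mulrAC mulrBl mul1r invfM -mulrA mulVf ?pnatr_eq0 // mulr1.
rewrite exprS -[n.+1%:R]natr1; move: rest; set X := \sum_(h <- _) _. lra.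
Qed.

Lemma half_pow_height_anti n N : (N <= n)%N -> half_pow_height n <= half_pow_height N.
Proof.
move=> Nn; have -> : n = (n - N + N)%N by rewrite subnK.
elim: (n - N)%N => [//|m IH]; apply: le_trans IH.
rewrite addSn; apply: le_trans (half_pow_heightS _) _; rewrite gerBl.
by rewrite mulr_ge0 ?half_pow_height_ge0 // invr_ge0 mulr_ge0.
Qed.

(** If it stayed above [e], its decrements would be at least [e / (2 * n.+1)],
whose sum diverges. *)
Lemma half_pow_height_small e : 0 < e -> exists N, forall n, (N <= n)%N -> half_pow_height n < e.
Proof.
move=> e0; apply: contrapT => /forallNP Nt.
have te n : e <= half_pow_height n.
  rewrite leNgt; apply/negP => tn; apply: (Nt n) => m nm.
  exact: le_lt_trans (half_pow_height_anti nm) tn.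
have [|n _] := @log_growth_slow_step R (fun n => - (12 / e * half_pow_height n)) 0 _ 0.
  move=> k n _; rewrite addr0; apply: (@le_trans _ _ 0).
    by rewrite oppr_le0 mulr_ge0 ?half_pow_height_ge0 // divr_ge0 // ltW.
  by rewrite mulr_ge0.
apply/negP; rewrite -leNgt.
have -> : - (12 / e * half_pow_height n.+1) - - (12 / e * half_pow_height n)
   = 12 / e * (half_pow_height n - half_pow_height n.+1) by ring.
have n0 : n.+1%:R != 0 :> R by rewrite pnatr_eq0.
have -> : 6 / n.+1%:R = 12 / e * (e / (2 * n.+1%:R)).
  by field; rewrite nat1r n0 gt_eqF.
rewrite ler_pM2l ?divr_gt0 // (@le_trans _ _ (half_pow_height n / (2 * n.+1%:R))) //.
  by rewrite ler_wpM2r ?te // invr_ge0 mulr_ge0.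
by rewrite lerBrDl -lerBrDr half_pow_heightS.
Qed.

End RecursiveTree.

(** * Growing from one or two active vertices *)

(** Attachments to a forest of two trees; the pair of trees competes for the new
vertices as the two colours of a Polya urn. *)
Section Forest.
Variable R : realType.

Definition pair_idx (p : state * state) : seq (nat + nat) :=
  [seq inl h | h <- p.1.2] ++ [seq inr h | h <- p.2.2].

Definition pair_next (p : state * state) (i : nat + nat) : state * state :=
  match i with
  | inl h => (next_state Attach p.1 h, p.2)
  | inr h => (p.1, next_state Attach p.2 h)
  end.

Definition pair_step : (state * state -> R) -> state * state -> R :=
  avg pair_idx pair_next.

Definition rrt2 n f : R := iter n pair_step f (root_state, root_state).

Definition pair_inv n (p : state * state) := (size p.1.2 + size p.2.2 = n.+2)%N.

Lemma pair_inv_next k p i :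
  pair_inv k p -> i \in pair_idx p -> pair_inv k.+1 (pair_next p i).
Proof. by rewrite /pair_inv; case: i => h /= + _; lia. Qed.

Lemma rrt2_le n f g :
  (forall p, pair_inv n p -> f p <= g p) -> rrt2 n f <= rrt2 n g.
Proof. by move=> fg; apply: (iter_avg_le (k := 0%N) pair_inv_next). Qed.

Lemma rrt2_eq n f g :
  (forall p, pair_inv n p -> f p = g p) -> rrt2 n f = rrt2 n g.
Proof. by move=> fg; apply: (iter_avg_eq (k := 0%N) pair_inv_next). Qed.

Lemma rrt2_lin n a f g : rrt2 n (fun t => a * f t + g t) = a * rrt2 n f + rrt2 n g.
Proof. exact: iter_avg_lin. Qed.

Lemma rrt2_const n c : rrt2 n (fun=> c) = c.
Proof.
apply: (iter_avg_const (k := 0%N) pair_inv_next); last by [].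
by move=> j t _; rewrite /pair_inv size_cat !size_map => ->.
Qed.

Lemma pair_step_fst (f : state -> R) p :
  pair_step (fun q => f q.1) p
  = ((size p.1.2)%:R * attach_step f p.1 + (size p.2.2)%:R * f p.1)
    / (size p.1.2 + size p.2.2)%:R.
Proof.
rewrite /pair_step /avg size_cat !size_map; congr (_ / _).
rewrite big_cat !big_map /=; congr (_ + _); last first.
  by rewrite big_const_seq count_predT iter_addr_0 mulr_natl.
rewrite /attach_step /depth_step /avg.
have [/size0nil ->|sz] := posnP (size p.1.2); first by rewrite !big_nil mul0r.
by rewrite mulrCA divff ?mulr1 // pnatr_eq0 -lt0n.
Qed.

(** In the Polya urn started from one ball of each colour the number of draws of a
given colour is uniform on [0, n], and given this number the tree is a
random recursive tree. The induction decomposes on the last step, where the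
size of the tree determines the urn. *)
Lemma rrt2_fst n (f : state -> R) :
  rrt2 n (fun p => f p.1) = (\sum_(k < n.+1) rrt k f) / n.+1%:R.
Proof.
elim: n f => [|n IH] f; first by rewrite /rrt2 big_ord1 divr1.
pose psi st : R := ((size st.2)%:R * attach_step f st
                    + (n.+2%:R - (size st.2)%:R) * f st) / n.+2%:R.
have -> : rrt2 n.+1 (fun p => f p.1) = rrt2 n (fun p => psi p.1).
  rewrite /rrt2 iterSr; apply: rrt2_eq => p pI.
  rewrite pair_step_fst /psi pI; congr ((_ + _ * _) / _).
  by rewrite -pI natrD addrAC subrr add0r.
rewrite IH.
have psiE k : rrt k psi
    = (k.+1%:R * rrt k.+1 f + (n.+2%:R - k.+1%:R) * rrt k f) / n.+2%:R.
  rewrite (@rrt_eq _ _ _ (fun st => (k.+1%:R / n.+2%:R) * attach_step f st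
             + (n.+2%:R - k.+1%:R) / n.+2%:R * f st)); last first.
    by move=> st [sz _]; rewrite /psi sz; ring.
  by rewrite rrt_lin rrtZ -rrtS; ring.
under eq_bigr do rewrite psiE.
rewrite -mulr_suml big_split /=.
have shift m : \sum_(k < m) k.+1%:R * rrt k.+1 f = \sum_(k < m.+1) k%:R * rrt k f.
  by rewrite [RHS]big_ord_recl mul0r add0r.
rewrite shift.
have -> : \sum_(k < n.+1) (n.+2%:R - k.+1%:R) * rrt k f
        = \sum_(k < n.+2) (n.+1%:R - k%:R) * rrt k f.
  rewrite [RHS]big_ord_recr /= subrr mul0r addr0.
  by apply: eq_bigr => k _; congr (_ * _); rewrite -!natr1; ring.
rewrite -big_split /=.
under eq_bigr do rewrite -mulrDl addrC subrK.
rewrite -mulr_sumr; field.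
by rewrite !nat1r -!natrD !pnatr_eq0.
Qed.

End Forest.

Section Shift.
Variable R : realType.

(** Expected final height when [n] attachments are made from a given state. *)
Definition grown n (st : state) : R := iter n (@attach_step R) (fun t => t.1%:R) st.

Lemma grown_perm n H l l' : perm_eq l l' -> grown n (H, l) = grown n (H, l').
Proof.
elim: n H l l' => [//|n IH] H l l' ll'; rewrite /grown /=.
rewrite {1 3}/attach_step /depth_step /avg /= (perm_size ll') (perm_big _ ll').
by congr (_ / _); apply: eq_bigr => h _; apply: IH; rewrite perm_cons.
Qed.

Lemma grown_swap n H a b : grown n (H, [:: a; b]) = grown n (H, [:: b; a]).
Proof. by apply: grown_perm; rewrite (perm_catC [:: a] [:: b]). Qed.

(** A tree grafted at depth [c] on a frozen tree of height [H0] has its depths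
shifted by [c] and its height floored at [H0]. *)
Lemma grown_shift n H0 c H s :
  grown n (maxn H0 (c + H), map (addn c) s)
  = iter n (@attach_step R) (fun t => (maxn H0 (c + t.1))%:R) (H, s).
Proof.
elim: n H s => [//|n IH] H s; rewrite /grown /=.
rewrite {1 3}/attach_step /depth_step /avg /= size_map big_map.
congr (_ / _); apply: eq_bigr => h _ /=.
rewrite -IH /grown; congr (iter _ _ _ (_, _)); last by rewrite /= addnS.
lia.
Qed.

(** Two trees grafted at depths [c] and [d]: the single list of active depths is
the shuffled union of the two shifted profiles. *)
Lemma grown_merge n H0 c d H1 s1 H2 s2 l :
  perm_eq l (map (addn c) s1 ++ map (addn d) s2) ->
  grown n (maxn H0 (maxn (c + H1) (d + H2)), l)
  = iter n (@pair_step R)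
      (fun p => (maxn H0 (maxn (c + p.1.1) (d + p.2.1)))%:R) ((H1, s1), (H2, s2)).
Proof.
elim: n H1 s1 H2 s2 l => [//|n IH] H1 s1 H2 s2 l lP; rewrite /grown /=.
rewrite /pair_step {1}/attach_step /depth_step /avg /= size_cat !size_map.
rewrite (perm_size lP) size_cat !size_map (perm_big _ lP) !big_cat !big_map /=.
congr ((_ + _) / _); apply: eq_bigr => h _ /=.
  rewrite -(IH _ _ _ _ ((c + h).+1 :: l)) /=; last by rewrite addnS perm_cons.
  rewrite /grown; congr (iter _ _ _ (_, _)); lia.
rewrite -(IH _ _ _ _ ((d + h).+1 :: l)) /=.
  rewrite /grown; congr (iter _ _ _ (_, _)); lia.
rewrite -addnS; move: lP; rewrite -(perm_cons (d + h.+1)) => /perm_trans; apply.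
by rewrite perm_sym -cat1s perm_catCA.
Qed.

Lemma grown_single n H c : (c <= H)%N ->
  grown n (H, [:: c]) = rrt n (fun t => (maxn H (c + t.1))%:R).
Proof.
by move=> cH; rewrite /rrt -grown_shift /= addn0; have -> : maxn H c = H by lia.
Qed.

Lemma grown_pair n H c d : (c <= H)%N -> (d <= H)%N ->
  grown n (H, [:: c; d])
  = rrt2 n (fun p => (maxn H (maxn (c + p.1.1) (d + p.2.1)))%:R).
Proof.
move=> cH dH; rewrite /rrt2 -(@grown_merge _ _ _ _ _ _ _ _ [:: c; d]) /= ?addn0 //.
by have -> : maxn H (maxn c d) = H by lia.
Qed.

Lemma grown_root n : grown n root_state = rrt_height R n.
Proof. by []. Qed.

(** The floor [H] costs only [H - H'] on the event that the grafted tree, of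
height [H'], stays below it, and this is at most [2 ^+ (m - H')]. *)
Lemma grown_single_le n H c m : (c <= H)%N -> (H <= m)%N ->
  grown n (H, [:: c]) <= c%:R + rrt_height R n + 2 ^+ m * half_pow_height R n.
Proof.
move=> cH Hm; rewrite grown_single //.
rewrite addrC /half_pow_height -(rrt_const n c%:R).
have -> : rrt n (fun=> c%:R) + rrt_height R n
        = rrt n (fun t => 1 * (fun=> c%:R) t + t.1%:R) by rewrite rrt_lin mul1r.
rewrite -rrt_lin; apply: rrt_le => t _; rewrite mul1r /=.
have [ct|tc] := leqP H (c + t.1).
  by rewrite natrD lerDr mulr_ge0 // exprn_ge0 // invr_ge0.
rewrite -[c%:R + _]natrD -[in leLHS](subnK (ltnW tc)) natrD lerD2r // exprVn -exprB ?unitfE ?pnatr_eq0 //; last lia.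
rewrite -natrX ler_nat.
apply: (@leq_trans (2 ^ (H - (c + t.1)))); first exact/ltnW/ltn_expl.
by rewrite leq_exp2l //; lia.
Qed.

Lemma grown_single_ge n H c : (c <= H)%N ->
  c%:R + rrt_height R n <= grown n (H, [:: c]).
Proof.
move=> cH; rewrite grown_single // -(rrt_const n c%:R) -[X in X + _]mul1r -rrt_lin.
by apply: rrt_le => t _; rewrite mul1r -natrD ler_nat leq_maxr.
Qed.

(** Mean height of one of two trees that share [n] attachments. *)
Definition split_height n : R := (\sum_(k < n.+1) rrt_height R k) / n.+1%:R.

Lemma grown_pair_gel n H c d : (c <= H)%N -> (d <= H)%N ->
  c%:R + split_height n <= grown n (H, [:: c; d]).
Proof.
move=> cH dH; rewrite grown_pair // /split_height /rrt_height.
rewrite -(rrt2_fst n (fun st => st.1%:R)).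
rewrite -(rrt2_const n c%:R) -[X in X + _]mul1r -rrt2_lin.
by apply: rrt2_le => p _; rewrite mul1r -natrD ler_nat; lia.
Qed.

Lemma grown_pair_ge n H c d : (c <= H)%N -> (d <= H)%N ->
  (maxn c d)%:R + split_height n <= grown n (H, [:: c; d]).
Proof.
move=> cH dH; case: (leqP c d) => cd; last exact: grown_pair_gel.
by rewrite grown_swap grown_pair_gel.
Qed.

(** Coupling: match the active vertices of the two states and always choose
matched ones. *)
Lemma grown_lipschitz n H H' (r : seq (nat * nat)) :
  (H <= H'.+1)%N -> {in r, forall q, (q.1 <= q.2.+1)%N} ->
  grown n (H, map fst r) <= grown n (H', map snd r) + 1.
Proof.
elim: n H H' r => [|n IH] H H' r HH rr; first by rewrite /grown /= natr1 ler_nat.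
rewrite /grown /= {1 3}/attach_step /depth_step /avg /= !size_map !big_map.
have [/size0nil ->|r0] := posnP (size r); first by rewrite !big_nil mul0r add0r.
have rn : (size r)%:R != 0 :> R by rewrite pnatr_eq0 -lt0n.
rewrite ler_pdivrMr ?ltr0n // mulrDl divfK // mul1r.
have -> : (size r)%:R = \sum_(q <- r) 1 :> R.
  by rewrite big_const_seq count_predT iter_addr_0.
rewrite -big_split /= !big_seq; apply: ler_sum => q qr.
apply: (IH _ _ ((q.1.+1, q.2.+1) :: r)); first by have := rr _ qr; lia.
by move=> t; rewrite inE => /orP[/eqP -> /=|/rr //]; have := rr _ qr; lia.
Qed.

(** For heights [H1], [H2] of the two trees, [c |-> max (c + H1) H2] is convex with
  [max H1 H2 + max (2 + H1) H2 <= 2 * max (1 + H1) H2 + 1],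
where the last 1 can be replaced by the indicator of [H2 = 1 + H1]. By symmetry
this event has probability at most 1/2; in the proof the inequality is added to
its mirror image, for which the two indicators are disjoint. *)
Lemma grown_convex n :
  grown n (1%N, [:: 1%N; 1%N]) + grown n (2%N, [:: 2%N; 0%N])
  <= 2 * rrt_height R n.+1 + 3 / 2.
Proof.
have e20 : grown n (2%N, [:: 2%N; 0%N]) = grown n (2%N, [:: 0%N; 2%N]).
  exact: grown_swap.
have e10 : rrt_height R n.+1 = grown n (1%N, [:: 1%N; 0%N]).
  by rewrite -grown_root /grown /= {1}/attach_step /depth_step /avg /= big_seq1 divr1.
have e01 : rrt_height R n.+1 = grown n (1%N, [:: 0%N; 1%N]).
  by rewrite e10 grown_swap.
suff : 2 * grown n (1%N, [:: 1%N; 1%N])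
     + (1 * grown n (2%N, [:: 2%N; 0%N]) + grown n (2%N, [:: 0%N; 2%N]))
  <= 2 * grown n (1%N, [:: 1%N; 0%N]) + (2 * grown n (1%N, [:: 0%N; 1%N]) + 3).
  by rewrite -e20 -e10 -e01; lra.
rewrite !grown_pair // -(rrt2_const n 3) -!rrt2_lin.
apply: rrt2_le => -[[H1 s1] [H2 s2]] _ /=.
rewrite mul1r -!natrM -!natrD ler_nat; lia.
Qed.

End Shift.

(** * The depth gap of two uniform vertices is unbounded in mean *)

Section Gap.
Variable R : realType.

Definition pair_sum (K : nat -> nat -> R) (st : state) : R :=
  \sum_(a <- st.2) \sum_(b <- st.2) K a b.

Section Kernel.
Variable K : nat -> nat -> R.
Hypothesis Kdiag : forall a, K a a = 0.
Hypothesis Ksym : forall a b, K a b = K b a.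

Lemma pair_sum_cons H H' h s :
  pair_sum K (H, h :: s) = pair_sum K (H', s) + 2 * \sum_(b <- s) K h b.
Proof.
rewrite /pair_sum /= big_cons big_cons Kdiag add0r.
under [X in _ + X = _]eq_bigr do rewrite big_cons Ksym.
by rewrite big_split /=; ring.
Qed.

Lemma pair_sum_perm H H' s s' :
  perm_eq s s' -> pair_sum K (H, s) = pair_sum K (H', s').
Proof.
move=> ss'; rewrite /pair_sum /= (perm_big _ ss'); apply: eq_bigr => a _.
exact: perm_big.
Qed.

Lemma pair_sum_rem H h s : h \in s ->
  pair_sum K (H, rem h s) = pair_sum K (H, s) - 2 * \sum_(b <- s) K h b.
Proof.
move=> hs; rewrite (pair_sum_perm H H (perm_to_rem hs)) (pair_sum_cons H H).
by rewrite (perm_big _ (perm_to_rem hs)) /= big_cons Kdiag; ring.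
Qed.

(** The average of [K] over ordered pairs of distinct active vertices, because [K]
vanishes on the diagonal. *)
Definition pair_mean (st : state) : R :=
  pair_sum K st / ((size st.2)%:R * (size st.2).-1%:R).

(** Removing a uniform element leaves a uniform pair uniform. *)
Lemma freeze_pair_mean st : (2 < size st.2)%N ->
  freeze_step pair_mean st = pair_mean st.
Proof.
case: st => H s /= s2; have [n sz] : exists n, size s = n.+3.
  by exists (size s - 3)%N; lia.
rewrite /freeze_step /depth_step /avg /= sz.
have -> : \sum_(h <- s) pair_mean (H, rem h s)
        = (\sum_(h <- s) pair_sum K (H, rem h s)) / (n.+2%:R * n.+1%:R).
  rewrite mulr_suml !big_seq; apply: eq_bigr => h hs.
  by rewrite /pair_mean /= size_rem // sz.
have -> : \sum_(h <- s) pair_sum K (H, rem h s) = n.+1%:R * pair_sum K (H, s).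
  under eq_big_seq do rewrite pair_sum_rem //.
  rewrite sumrB big_const_seq count_predT iter_addr_0 sz -mulr_sumr.
  by rewrite -/(pair_sum K (H, s)) -[_ *+ _]mulr_natl -!natr1; ring.
rewrite /pair_mean /= sz /=; field.
by rewrite !nat1r -!natrD !pnatr_eq0.
Qed.

Lemma iter_freeze_pair_mean j st : size st.2 = j.+2 ->
  iter j (@freeze_step R) pair_mean st = pair_mean st.
Proof.
elim: j st => [//|j IH] st sz; rewrite iterS -[RHS]freeze_pair_mean ?sz //.
by apply: avg_eq => h hs; apply: IH; rewrite /= size_rem // sz.
Qed.

End Kernel.

Definition gap (a b : nat) : R := `|a%:R - b%:R|.

Lemma gap_diag a : gap a a = 0. Proof. by rewrite /gap subrr normr0. Qed.

Lemma gap_sym a b : gap a b = gap b a. Proof. exact: distrC. Qed.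

(** For small [c], the second difference of [x ^+ 2 - c * x ^+ 3] is close to 2 near
0, while the function is at most linear on the half-line. Its mean therefore
grows with the logarithm of time as long as the mean gap is bounded, and is
bounded in terms of the mean gap. *)
Definition cubic c (a b : nat) : R := gap a b ^+ 2 - c * gap a b ^+ 3.

Lemma cubic_diag c a : cubic c a a = 0.
Proof. by rewrite /cubic gap_diag !expr0n /= mulr0 subr0. Qed.

Lemma cubic_sym c a b : cubic c a b = cubic c b a.
Proof. by rewrite /cubic gap_sym. Qed.

Lemma cubic_le_gap c a b : 0 < c -> cubic c a b <= gap a b / (4 * c).
Proof.
move=> c0; rewrite ler_pdivlMr ?mulr_gt0 // /cubic.
have := normr_ge0 (a%:R - b%:R : R); rewrite -/(gap a b); move: (gap a b) => x x0.
rewrite -subr_ge0.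
have -> : x - (x ^+ 2 - c * x ^+ 3) * (4 * c) = x * (1 - 2 * c * x) ^+ 2 by ring.
by rewrite mulr_ge0 ?sqr_ge0.
Qed.

Lemma gapE (a b : nat) : (a <= b)%N -> gap a b = b%:R - a%:R.
Proof. by move=> ab; rewrite gap_sym /gap ger0_norm // subr_ge0 ler_nat. Qed.

Lemma cubic_second_difference c a b : 0 <= c ->
  2 * cubic c a b + 2 * (1 - c) - 6 * c * gap a b
  <= cubic c a.+1 b + cubic c b.+1 a.
Proof.
move=> c0; wlog ab : a b / (a <= b)%N => [wl|].
  have [/wl //|/ltnW/wl] := leqP a b.
  by rewrite [cubic c a b]cubic_sym [gap a b]gap_sym [leRHS]addrC.
case: ltngtP ab => // [ab|<-] _.
  rewrite /cubic (gapE (ltnW ab)) (gapE ab) [gap b.+1 a]gap_sym.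
  rewrite (gapE (leq_trans (ltnW ab) (leqnSn b))) -!natr1.
  have : 0 <= c * (b%:R - a%:R) by rewrite mulr_ge0 // subr_ge0 ler_nat ltnW.
  lra.
rewrite cubic_diag gap_diag /cubic [gap _ a]gap_sym (gapE (leqnSn a)).
have -> : a.+1%:R - a%:R = 1 :> R by rewrite -natr1; ring.
lra.
Qed.

(** A new vertex forms pairs with the old ones as its parent does, with the gap
moved by one; by symmetry both directions occur equally often, which brings in
the second difference of the kernel. *)
Lemma attach_pair_sum_cubic c (n : nat) st : 0 <= c -> size st.2 = n.+1 ->
  pair_sum (cubic c) st * (n.+3%:R / n.+1%:R) + 2 * (1 - c) * n.+1%:R
    - 6 * c / n.+1%:R * pair_sum gap st
  <= attach_step (pair_sum (cubic c)) st.
Proof.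
case: st => H s /= c0 sz; rewrite /attach_step /depth_step /avg /= sz.
have n0 : n.+1%:R != 0 :> R by rewrite pnatr_eq0.
rewrite ler_pdivlMr ?ltr0n //.
have -> : \sum_(h <- s) pair_sum (cubic c) (maxn H h.+1, h.+1 :: s)
  = n.+1%:R * pair_sum (cubic c) (H, s)
    + \sum_(h <- s) \sum_(b <- s) (cubic c h.+1 b + cubic c b.+1 h).
  under eq_bigr do rewrite (pair_sum_cons (cubic_diag c) (cubic_sym c) _ H).
  rewrite big_split /= big_const_seq count_predT iter_addr_0 sz -[_ *+ _]mulr_natl.
  congr (_ + _); rewrite -mulr_sumr.
  under [RHS]eq_bigr do rewrite big_split /=.
  by rewrite big_split /= [X in _ = _ + X]exchange_big /=; ring.
apply: (@le_trans _ _ (n.+1%:R * pair_sum (cubic c) (H, s)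
  + \sum_(h <- s) \sum_(b <- s)
      (2 * cubic c h b + 2 * (1 - c) - 6 * c * gap h b))); last first.
  by rewrite lerD2l; do 2 (apply: ler_sum => ? _); apply: cubic_second_difference.
rewrite le_eqVlt; apply/orP; left; apply/eqP.
have -> : \sum_(h <- s) \sum_(b <- s)
      (2 * cubic c h b + 2 * (1 - c) - 6 * c * gap h b)
  = 2 * pair_sum (cubic c) (H, s) + n.+1%:R * (n.+1%:R * (2 * (1 - c)))
    - 6 * c * pair_sum gap (H, s).
  rewrite /pair_sum /=.
  under eq_bigr do rewrite sumrB big_split /= big_const_seq count_predT iter_addr_0 sz
     -!mulr_sumr.
  rewrite sumrB big_split /= big_const_seq count_predT iter_addr_0 sz.
  by rewrite -!mulr_sumr; ring.
have -> : n.+3%:R = n.+1%:R + 2 :> R by rewrite -[n.+3]/(2 + n.+1)%N natrD addrC.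
by field; rewrite nat1r.
Qed.

(** Expectation of [f] after [m] attachments and [m - 1] freezings, when two active
vertices remain. *)
Definition two_left m (f : state -> R) : R :=
  rrt m (iter (m - 1) (@freeze_step R) f).

Lemma two_left_gap m : (0 < m)%N ->
  two_left m (pair_mean gap) = rrt m (pair_sum gap) / (m.+1 * m)%:R.
Proof.
move=> m0; rewrite mulrC -rrtZ; apply: rrt_eq => st [sz _].
rewrite (iter_freeze_pair_mean gap_diag gap_sym) ?sz; last lia.
by rewrite /pair_mean sz /= natrM mulrC.
Qed.

(** If the mean gap stayed below [A], the normalised mean of the cubic kernel would
be bounded and yet grow harmonically. *)
Lemma gap_unbounded (A : R) : exists2 m, (0 < m)%N & A <= two_left m (pair_mean gap).
Proof.
wlog A0 : A / 0 < A => [wl|].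
  have [|m m0 Am] := wl (`|A| + 1); first by rewrite ltr_wpDl.
  by exists m => //; apply: le_trans Am; rewrite (le_trans (ler_norm _)) // lerDl.
apply: contrapT => /forall2NP Am.
(* small enough that [c <= 4^-1] and [6 * c * A <= 4^-1] *)
pose c : R := (4 + 24 * A)^-1.
have c0 : 0 < c by rewrite invr_gt0; lra.
have cE : c * (4 + 24 * A) = 1 by rewrite mulVf // gt_eqF //; lra.
have gapA n : (0 < n)%N -> rrt n (pair_sum gap) <= A * (n.+1 * n.+2)%:R.
  move=> n0; case: (Am n) => // /negP; rewrite -ltNge two_left_gap //.
  rewrite ltr_pdivrMr ?ltr0n ?muln_gt0 // => /ltW /le_trans; apply.
  by rewrite ler_pM2l // ler_nat; nia.
(* dividing by [n.+1 * n.+2] rather than by the number [n.+1 * n] of pairs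
   cancels the factor [n.+3 / n.+1] of the recursion exactly *)
pose u n := rrt n (pair_sum (cubic c)) / (n.+1 * n.+2)%:R.
have u_le n : (0 < n)%N -> u n <= A / (4 * c).
  move=> n0; rewrite ler_pdivrMr ?ltr0n // mulrAC.
  rewrite ler_pdivlMr ?mulr_gt0 // mulrC; apply: le_trans (gapA n n0).
  rewrite -rrtZ; apply: rrt_le => st _; rewrite /pair_sum mulr_sumr.
  apply: ler_sum => a _; rewrite mulr_sumr; apply: ler_sum => b _.
  by rewrite mulrC -ler_pdivlMr ?mulr_gt0 // cubic_le_gap.
have u_step n : (0 < n)%N -> u n + (2 * n.+3%:R)^-1 <= u n.+1.
  move=> n0; have : rrt n (pair_sum (cubic c)) * (n.+3%:R / n.+1%:R)
       + 2 * (1 - c) * n.+1%:R - 6 * c / n.+1%:R * (A * (n.+1 * n.+2)%:R)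
       <= rrt n.+1 (pair_sum (cubic c)).
    apply: (@le_trans _ _ (rrt n (fun st => (n.+3%:R / n.+1%:R) * pair_sum (cubic c) st
      + ((- (6 * c / n.+1%:R)) * pair_sum gap st + 2 * (1 - c) * n.+1%:R)))).
      rewrite !rrt_lin rrt_const.
      have : 6 * c / n.+1%:R * rrt n (pair_sum gap)
          <= 6 * c / n.+1%:R * (A * (n.+1 * n.+2)%:R).
        by rewrite ler_wpM2l ?gapA // divr_ge0 // mulr_ge0 // ltW.
      move: (rrt n (pair_sum gap)) (A * _) (n.+3%:R / _) (6 * c / _) (2 * _ * _).
      by move=> x y z k w; lra.
    rewrite rrtS; apply: rrt_le => st [sz _].
    by have := attach_pair_sum_cubic (ltW c0) sz; congr (_ <= _); ring.
  move=> step; rewrite [u n.+1]/u ler_pdivlMr ?ltr0n //.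
  apply: le_trans _ step.
  have cA : c * A = (1 - 4 * c) / 24 by lra.
  have c4 : c <= 4^-1 by rewrite lef_pV2 ?posrE; lra.
  have -> : 6 * c / n.+1%:R * (A * (n.+1 * n.+2)%:R)
      = 6 * (c * A) * n.+2%:R :> R.
    by rewrite natrM; field; rewrite nat1r pnatr_eq0.
  have -> : (u n + (2 * n.+3%:R)^-1) * (n.+2 * n.+3)%:R
      = rrt n (pair_sum (cubic c)) * (n.+3%:R / n.+1%:R) + n.+2%:R / 2.
    by rewrite /u !natrM; field; rewrite !nat1r -!natrD !pnatr_eq0.
  rewrite -addrA lerD2l cA.
  have -> : n.+2%:R = n.+1%:R + 1 :> R by rewrite natr1.
  have : 2 <= n.+1%:R :> R by rewrite ler_nat.
  move: (n.+1%:R) => x x2; nra.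
have [k n _|n n1] := @log_growth_slow_step R (fun n => 36 * u n)
    (36 * (A / (4 * c)) + 36 * `|u 0%N|) _ 1%N.
  have k0 : 0 <= 2 * k%:R :> R by rewrite mulr_ge0.
  have B0 : 0 <= A / (4 * c) by rewrite divr_ge0 ?mulr_ge0 // ltW.
  have := normr_ge0 (u 0%N); case: n => [|n]; first by have := ler_norm (u 0%N); lra.
  by have := u_le n.+1 isT; lra.
apply/negP; rewrite -leNgt -mulrBr ler_pdivrMr ?ltr0n //.
have := u_step n n1; rewrite -lerBrDl => /(ler_wpM2r (ler0n R n.+1)).
have : 6^-1 <= (2 * n.+3%:R)^-1 * n.+1%:R :> R.
  rewrite mulrC ler_pdivlMr ?mulr_gt0 ?ltr0n // mulrC ler_pdivrMr //.
  by rewrite -!natrM ler_nat; lia.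
move: (_ * n.+1%:R) => x; move: (u n.+1 - u n) (n.+1%:R) => y z; nra.
Qed.

End Gap.

(** * Comparing the choice sequences *)

Section Main.
Variable R : realType.
Implicit Types f g : state -> R.

(** [m] bounds the height reached by the time only two vertices are active, and
thus the floor that later growth has to pass. *)
Definition bounded_inv (N m : nat) (st : state) : Prop :=
  [/\ size st.2 = N, {in st.2, forall h, h <= st.1}%N & (st.1 <= m)%N].

Lemma attach_bounded_inv k st h :
  bounded_inv k.+1 k st -> h \in st.2 ->
  bounded_inv k.+2 k.+1 (next_state Attach st h).
Proof.
case=> sz le Hk /le hH; split; rewrite /= ?sz //; last by lia.
by move=> i; rewrite inE => /predU1P[->|/le]; lia.
Qed.

Lemma freeze_bounded_inv m k st h :
  bounded_inv (m.+1 - k) m st -> h \in st.2 ->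
  bounded_inv (m.+1 - k.+1) m (next_state Freeze st h).
Proof.
case=> sz le Hk hs; split=> //=; first by rewrite size_rem // sz; lia.
by move=> i /mem_rem/le.
Qed.

(** The state left before the final growth consists of two depths below a height
that is at most [m]. *)
Lemma two_left_le m f g : (0 < m)%N ->
    (forall H h1 h2, (h1 <= H)%N -> (h2 <= H)%N -> (H <= m)%N ->
       f (H, [:: h1; h2]) <= g (H, [:: h1; h2])) ->
  two_left m f <= two_left m g.
Proof.
move=> m0 fg; rewrite /two_left /rrt.
apply: (iter_avg_le attach_bounded_inv (k := 0%N)) => [st stI|]; last first.
  by split=> // h; rewrite inE => /eqP->.
apply: (iter_avg_le (@freeze_bounded_inv m) (k := 0%N)); last by rewrite subn0.
case=> [H [|h1 [|h2 [|? ?]]]] [/= sz le Hm]; try lia.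
by apply: fg => //; apply: le; rewrite !inE eqxx ?orbT.
Qed.

Lemma two_left_lin m a f g :
  two_left m (fun st => a * f st + g st) = a * two_left m f + two_left m g.
Proof. by rewrite -rrt_lin; apply: rrt_eq => st _; apply: iter_avg_lin. Qed.

Lemma two_left_const m (c : R) : (0 < m)%N -> two_left m (fun=> c) = c.
Proof.
move=> m0; rewrite -[RHS](rrt_const m); apply: rrt_eq => st [sz _].
apply: (iter_avg_const (Inv := fun k (st : state) => size st.2 = (m.+1 - k)%N) _ (k := 0%N)).
- by move=> k t h tk ht; rewrite /= size_rem // tk; lia.
- by move=> j t jm ->; lia.
- by rewrite sz subn0.
Qed.

Lemma mean_height_two_left m y :
  mean_height R (nseq m Attach ++ nseq (m - 1) Freeze ++ y)
  = two_left m (foldr (@depth_step R) (fun st => st.1%:R) y).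
Proof.
have foldr_nseq k s z (f : state -> R) : foldr (@depth_step R) f (nseq k s ++ z)
    = iter k (depth_step s) (foldr (@depth_step R) f z).
  by elim: k => //= k ->.
by rewrite mean_height_depth_step !foldr_nseq.
Qed.

Lemma foldr_grown n :
  foldr (@depth_step R) (fun st => st.1%:R) (nseq n Attach) = grown R n.
Proof. by rewrite /grown; elim: n => //= n ->. Qed.

Lemma freeze_pair f H a b :
  freeze_step f (H, [:: a; b]) = (f (H, [:: b]) + f (H, [:: a])) / 2.
Proof.
rewrite /freeze_step /depth_step /avg /= !big_cons big_nil addr0 /= !eqxx.
by case: eqVneq => [->|].
Qed.

Lemma freeze_triple n H a b c :
  freeze_step (grown R n) (H, [:: a; b; c])
  = (grown R n (H, [:: b; c]) + grown R n (H, [:: a; c])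
     + grown R n (H, [:: a; b])) / 3.
Proof.
rewrite /freeze_step /depth_step /avg /= !big_cons big_nil addr0 /= !eqxx addrA.
congr ((_ + _ + _) / _); first by case: eqVneq => [->|].
case: eqVneq => [->|_]; first exact: grown_swap.
by case: eqVneq => [->|].
Qed.

Lemma attach_pair f H a b :
  attach_step f (H, [:: a; b])
  = (f (maxn H a.+1, [:: a.+1; a; b]) + f (maxn H b.+1, [:: b.+1; a; b])) / 2.
Proof. by rewrite /attach_step /depth_step /avg /= !big_cons big_nil addr0. Qed.

Lemma attach_single f H a :
  attach_step f (H, [:: a]) = f (maxn H a.+1, [:: a.+1; a]).
Proof. by rewrite /attach_step /depth_step /avg /= big_seq1 divr1. Qed.

Lemma grownS n st : grown R n.+1 st = attach_step (grown R n) st.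
Proof. by []. Qed.

Lemma grown_mono n st : (0 < size st.2)%N -> grown R n st <= grown R n.+1 st.
Proof.
rewrite {2}/grown iterSr => sz.
apply: (iter_avg_le (Inv := fun _ (t : state) => (0 < size t.2)%N) _ (k := 0%N)) => //.
move=> t tz; rewrite -[leLHS](avg_const (@next_state Attach) _ tz).
by apply: avg_le => h _; rewrite ler_nat leq_maxl.
Qed.

Lemma split_height_log k n : (n <= 2 ^ k)%N -> split_height R n <= 2 * k%:R + 3.
Proof.
move=> nk; rewrite ler_pdivrMr ?ltr0n //.
have -> : (2 * k%:R + 3) * n.+1%:R = \sum_(i < n.+1) (2 * k%:R + 3) :> R.
  by rewrite sumr_const card_ord mulr_natr.
apply: ler_sum => i _; apply: rrt_height_log.
by apply: leq_trans nk; rewrite -ltnS.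
Qed.

Lemma split_heightS n :
  split_height R n.+1 - split_height R n
  = (rrt_height R n.+1 - split_height R n) / n.+2%:R.
Proof.
rewrite {1}/split_height big_ord_recr /=.
have -> : \sum_(i < n.+1) rrt_height R i = n.+1%:R * split_height R n.
  by rewrite mulrC divfK // pnatr_eq0.
rewrite -[n.+2%:R]natr1; field.
by rewrite nat1r natr1 -?natrD pnatr_eq0.
Qed.

(** Each increment of the running average [split_height] is [n.+2^-1] times its
distance to [rrt_height n.+1]; were this distance eventually larger than 12, the
average would outgrow its logarithmic bound. *)
Lemma balanced_time m : exists n,
  rrt_height R n.+1 <= split_height R n + 12 /\ 2 ^+ m * half_pow_height R n.+1 <= 1.
Proof.
have [|N tN] := @half_pow_height_small R (2 ^+ m)^-1; first by rewrite invr_gt0 exprn_gt0.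
have [n Nn] := log_growth_slow_step split_height_log N.
rewrite split_heightS ltr_pdivrMr ?ltr0n // => hn.
exists n; split; last first.
  by rewrite mulrC -ler_pdivlMr ?exprn_gt0 // div1r ltW // tN // (leq_trans Nn).
have : 6 / n.+1%:R * n.+2%:R <= 12 :> R.
  by rewrite mulrAC ler_pdivrMr ?ltr0n // -!natrM ler_nat; lia.
by move=> le12; rewrite -lerBlDl (le_trans (ltW hn)).
Qed.

(** With two active vertices the growth of the deeper one already gives the lower
bound, and sharing the attachments costs at most 12; with a single one, a uniform
choice among the two, the growth starts from [(a + b) / 2] on average. These
starting depths differ by half the gap; the last unit of 13 is for the floor. *)
Lemma grown_pair_gain m n H a b :
    rrt_height R n.+1 <= split_height R n + 12 -> 2 ^+ m * half_pow_height R n.+1 <= 1 ->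
    (a <= H)%N -> (b <= H)%N -> (H <= m)%N ->
  (grown R n.+1 (H, [:: a]) + grown R n.+1 (H, [:: b])) / 2 + gap R a b / 2 - 13
  <= grown R n (H, [:: a; b]).
Proof.
move=> hn tn aH bH Hm; apply: le_trans (grown_pair_ge _ n aH bH).
have := grown_single_le R n.+1 aH Hm; have := grown_single_le R n.+1 bH Hm.
have -> : (maxn a b)%:R = (a%:R + b%:R + gap R a b) / 2 :> R.
  have [ab|/ltnW ba] := leqP a b; first by rewrite gapE //; field.
  by rewrite gap_sym gapE //; field.
move: (gap R a b) (2 ^+ m * _) tn => x y; lra.
Qed.

Lemma pair_mean_gap H a b : pair_mean (gap R) (H, [:: a; b]) = gap R a b.
Proof.
rewrite /pair_mean /pair_sum /= !big_cons !big_nil !gap_diag [gap R b a]gap_sym.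
by rewrite /= ; field.
Qed.

Lemma freeze_attach_loses (A : R) : exists n m, (1 <= m)%N /\
  two_left m (freeze_step (attach_step (grown R n))) + A <= two_left m (grown R n).
Proof.
have [m m0 Am] := gap_unbounded (2 * (A + 13)).
have [n [hn tn]] := balanced_time m; exists n, m; split=> //.
apply: (@le_trans _ _ (two_left m (fun st => 2^-1 * pair_mean (gap R) st
   + (1 * freeze_step (grown R n.+1) st + -13)))).
  by rewrite !two_left_lin two_left_const // mul1r; lra.
apply: two_left_le => // H a b aH bH Hm; rewrite pair_mean_gap freeze_pair.
have := grown_pair_gain hn tn aH bH Hm; lra.
Qed.

(** After an attachment and a freezing, with probability 1/3 the remaining two
vertices are a parent and its child, which is the situation of a single active
vertex; otherwise the state is within one of the original pair. *)
Lemma attach_freeze_loses (A : R) : exists n m, (1 <= m)%N /\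
  two_left m (attach_step (freeze_step (grown R n))) + A <= two_left m (grown R n).
Proof.
have [m m0 Am] := gap_unbounded (6 * (A + 5)).
have [n [hn tn]] := balanced_time m; exists n, m; split=> //.
apply: (@le_trans _ _ (two_left m (fun st => 6^-1 * pair_mean (gap R) st
   + (1 * attach_step (freeze_step (grown R n)) st + -5)))).
  by rewrite !two_left_lin two_left_const // mul1r; lra.
apply: two_left_le => // H a b aH bH Hm; rewrite pair_mean_gap attach_pair.
rewrite !freeze_triple.
have := grown_pair_gain hn tn aH bH Hm.
have child c : grown R n (maxn H c.+1, [:: c.+1; c]) = grown R n.+1 (H, [:: c]).
  by rewrite grownS attach_single.
rewrite -!child.
have lip c u v : (u <= a.+1)%N -> (v <= b.+1)%N -> (c <= H)%N ->
    grown R n (maxn H c.+1, [:: u; v]) <= grown R n (H, [:: a; b]) + 1.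
  move=> ua vb cH; apply: (@grown_lipschitz R n _ _ [:: (u, a); (v, b)]).
    by lia.
  by move=> q; rewrite !inE => /orP[]/eqP->.
have := lip a a b (leqnSn _) (leqnSn _) aH.
have := lip a a.+1 b (leqnn _) (leqnSn _) aH.
have := lip b a b (leqnSn _) (leqnSn _) bH.
have := lip b a b.+1 (leqnSn _) (leqnn _) bH.
by rewrite (grown_swap R n _ b.+1 a); lra.
Qed.

(** A logarithmic bound forces increments of the mean height below [6 / n.+1] for
arbitrarily large [n], when the chance of a low tree is small as well. *)
Lemma small_increment : exists n,
  rrt_height R n.+1 + 2 / 3 * half_pow_height R n.+1 < rrt_height R n + 12^-1.
Proof.
(* 1/24 for the increment and 2/3 * 1/32 for the low trees: less than 1/12 *)
have [N tN] := @half_pow_height_small R 32^-1 ltac:(by rewrite invr_gt0).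
have [n Nn hn] := log_growth_slow_step (@rrt_height_log R) (N + 144).
have tn : half_pow_height R n.+1 < 32^-1 by apply: tN; lia.
have h6 : 6 / n.+1%:R <= 24^-1 :> R.
  rewrite ler_pdivrMr ?ltr0n // mulrC ler_pdivlMr // -natrM ler_nat; lia.
by exists n; have := lt_le_trans hn h6; lra.
Qed.

(** After one attachment and one freezing, the active vertex has depth 0 or 1, so
the mean height is about [rrt_height n + 1/2]. After two attachments and one
freezing the two active depths are (1,0) or (2,1), or else (1,1) and (2,0)
equally likely, and convexity bounds the mean height by about
[rrt_height n.+1 + 5/12]. One more attachment adds less than the
difference for suitable [n]. *)
Lemma early_freeze_gains : exists n,
  mean_height R ([:: Attach; Attach; Freeze] ++ nseq n Attach)
  < mean_height R ([:: Attach; Freeze] ++ nseq n Attach).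
Proof.
have [n hn] := small_increment; exists n.
rewrite !mean_height_depth_step !foldr_cat !foldr_grown /=.
rewrite -[depth_step Attach]/(@attach_step R) -[depth_step Freeze]/(@freeze_step R) !attach_single attach_pair freeze_pair.
rewrite !freeze_triple (_ : maxn 0 1 = 1%N) // (_ : maxn 1 2 = 2%N) // maxnn.
have e10 : rrt_height R n.+1 = grown R n (1%N, [:: 1%N; 0%N]).
  by rewrite -grown_root grownS attach_single.
have e2 : grown R n.+1 (2%N, [:: 0%N]) = grown R n (2%N, [:: 1%N; 0%N]).
  by rewrite grownS attach_single.
have e21 : grown R n (2%N, [:: 2%N; 1%N]) <= grown R n (1%N, [:: 1%N; 0%N]) + 1.
  apply: (@grown_lipschitz R n 2 1 [:: (2, 1); (1, 0)]%N) => //.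
  by move=> q; rewrite !inE => /orP[]/eqP->.
have := @grown_single_le R n.+1 2 0 2 isT isT.
have := @grown_single_ge R n 1 0 isT.
have := @grown_single_ge R n 1 1 isT.
have := grown_convex R n.
rewrite e2 -e10 in e21 *; rewrite expr2; lra.
Qed.

End Main.

Theorem proposition1 (R : realType) :
  (forall A : R, 0 < A ->
     exists n m : nat, (1 <= m)%N /\
       let x := nseq m Attach ++ nseq (m - 1) Freeze
                  ++ [:: Freeze; Attach] ++ nseq n Attach in
       let xhat := nseq m Attach ++ nseq (m - 1) Freeze ++ nseq n Attach in
       let xbar := nseq m Attach ++ nseq (m - 1) Freeze ++ nseq n.+1 Attach in
       mean_height R x + A <= mean_height R xhat /\
       mean_height R x + A <= mean_height R xbar)
  /\
  (forall A : R, 0 < A ->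
     exists n m : nat, (1 <= m)%N /\
       let x := nseq m Attach ++ nseq (m - 1) Freeze
                  ++ [:: Attach; Freeze] ++ nseq n Attach in
       let xhat := nseq m Attach ++ nseq (m - 1) Freeze ++ nseq n Attach in
       mean_height R x + A <= mean_height R xhat)
  /\
  (exists n : nat,
     let x := [:: Attach; Attach; Freeze] ++ nseq n Attach in
     let xhat := [:: Attach; Freeze] ++ nseq n Attach in
     mean_height R x < mean_height R xhat).
Proof.
split; [|split; last exact: early_freeze_gains].
- move=> A _; have [n [m [m0 le]]] := freeze_attach_loses A; exists n, m; split=> //=.
  rewrite !mean_height_two_left /= foldr_grown.
  split; first exact: le.
  apply: le_trans le _; rewrite -[depth_step _ _]/(grown R n.+1).
  by apply: two_left_le => // *; apply: grown_mono.
- move=> A _; have [n [m [m0 le]]] := attach_freeze_loses A; exists n, m; split=> //=.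
  by rewrite !mean_height_two_left /= foldr_grown.
Qed.
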